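(* Let $r$ be a positive integer. If $\varepsilon\in\left[\frac{1}{r+1/(r^2+r+1)},\frac{1}{r}\right)$, then the lower bound $\mu(3;\varepsilon)\geq\left\lceil \frac1\varepsilon\left\lceil \frac1\varepsilon\left\lceil \frac1\varepsilon\right\rceil\right\rceil\right\rceil$ is tight, i.e. $\mu(3;\varepsilon)=r^3+r^2+r+1$.
   Context: For a positive integer $d$ and a real $\varepsilon\in(0,1)$, let $T^d=[\mathbb{R}/\mathbb{Z}]^d$ be the $d$-dimensional torus. An $\varepsilon$-sub-cube of $T^d$ is a set of the form $\{(x_1,\ldots,x_d): x_i\in[x_i^0,x_i^0+\varepsilon] \text{ for all } i\}$, where $x_1^0,\dots,x_d^0\in\mathbb{R}/\mathbb{Z}$ and $[x_i^0,x_i^0+\varepsilon]$ denotes the image in $\mathbb{R}/\mathbb{Z}$ of the corresponding closed real interval of length $\varepsilon$. $\mu(d;\varepsilon)$ denotes the minimum number of $\varepsilon$-sub-cubes whose union is $T^d$. *)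

(* Defs.v *)
From HB Require Import structures.
From mathcomp Require Import all_boot all_order all_algebra.
From mathcomp Require Import all_classical all_reals.
From mathcomp Require Import lra.

Set Implicit Arguments.
Unset Strict Implicit.
Unset Printing Implicit Defensive.

Import Order.TTheory GRing.Theory Num.Theory.

Local Open Scope classical_set_scope.
Local Open Scope ring_scope.
Local Open Scope quotient_scope.

(* Num.int, bundled as an additive subgroup of R. *)
Definition int_subgroup (R : realType) : zmodClosed R :=
  GRing.ZmodClosed.clone R Num.int_num_subdef _.

(* R/Z *)
Notation circle R := (Quotient.quot (int_subgroup R)).

Definition torus (R : realType) (d : nat) : Type := 'I_d -> circle R.

(* Does not depend on the representative of a: see arc_pi. *)
Definition arc (R : realType) (eps : R) (a : circle R) : set (circle R) :=
  \pi_(circle R) @` `[repr a, repr a + eps].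

Definition subcube (R : realType) (d : nat) (eps : R) (x0 : torus R d) :
    set (torus R d) :=
  [set x | forall i, arc eps (x0 i) (x i)].

Definition coverable (R : realType) (d : nat) (eps : R) (n : nat) : Prop :=
  exists c : 'I_n -> torus R d, \bigcup_i subcube eps (c i) = setT.

(* The minimum of a set of naturals, see mu_min; the value 0 stands for the
   absence of finite covers, which does not occur for 0 < eps, see
   coverable_exists. *)
Definition mu (R : realType) (d : nat) (eps : R) : nat :=
  if pselect (exists n, `[< coverable d eps n >]) is left ex
  then ex_minn ex else 0%N.

Lemma pi_circle_eq (R : realType) (x y : R) :
  \pi_(circle R) x = \pi_(circle R) y <-> x - y \is a Num.int.
Proof.
have E := Quotient.idealrBE (int_subgroup R) x y.
by split=> [/eqP h|h]; [have := E; rewrite h | apply/eqP; rewrite -E].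
Qed.

Lemma arc_pi (R : realType) (eps x : R) :
  arc eps (\pi_(circle R) x) = \pi_(circle R) @` `[x, x + eps].
Proof.
set s := repr (\pi_(circle R) x).
have sx : s - x \is a Num.int by apply/pi_circle_eq; rewrite reprK.
apply/seteqP; split=> _ [t /= t_in <-].
- exists (t - (s - x)).
    by move: t_in; rewrite /= !in_itv /= -/s => /andP[? ?]; apply/andP; split; lra.
  by apply/pi_circle_eq; rewrite [_ - t]addrC addKr rpredN.
- exists (t + (s - x)).
    by move: t_in; rewrite /= !in_itv /= -/s => /andP[? ?]; apply/andP; split; lra.
  by apply/pi_circle_eq; rewrite [_ - t]addrC addKr.
Qed.

Lemma mu_min (R : realType) (d : nat) (eps : R) (n : nat) :
  coverable d eps n ->
  coverable d eps (mu d eps) /\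
  forall m, coverable d eps m -> (mu d eps <= m)%N.
Proof.
move=> cov; rewrite /mu; case: pselect => [ex|[]]; last by exists n; apply/asboolP.
by case: ex_minnP => m /asboolP covm le_m; split=> // k /asboolP/le_m.
Qed.

Lemma coverable_exists (R : realType) (d : nat) (eps : R) :
  0 < eps -> exists n, coverable d eps n.
Proof.
move=> eps0.
pose N := (Num.truncn eps^-1).+1; have epsV0 : 0 < eps^-1 by rewrite invr_gt0.
pose p (f : {ffun 'I_d -> 'I_N}) : torus R d :=
  fun i => \pi_(circle R) ((f i)%:R * eps).
exists #|{ffun 'I_d -> 'I_N}|, (fun j => p (enum_val j)).
apply/seteqP; split=> // x _.
pose t i : R := repr (x i) - (Num.floor (repr (x i)))%:~R.
have t0 i : 0 <= t i by rewrite subr_ge0 floor_le.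
have t1 i : t i < 1 by have := floorD1_gt (repr (x i)); rewrite intrD /t; lra.
have te0 i : 0 <= t i / eps by rewrite divr_ge0 // ltW.
have kP i : (Num.truncn (t i / eps) < N)%N.
  by rewrite ltnS le_truncn // ler_piMl ?ltW.
pose f : {ffun 'I_d -> 'I_N} := [ffun i => Ordinal (kP i)].
exists (enum_rank f) => //= i; rewrite enum_rankK /p ffunE /= arc_pi /=.
exists (t i); last first.
  rewrite -[RHS]reprK; apply/pi_circle_eq.
  by rewrite /t addrAC subrr add0r; apply: (@rpredNr _ (int_subgroup R)); apply: intr_int.
have /andP[le_k lt_k] := truncn_itv (te0 i).
rewrite in_itv /= -ler_pdivlMr // le_k /=.
rewrite ltr_pdivrMr // in lt_k.
by move: lt_k; rewrite -natr1 mulrDl mul1r => /ltW.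
Qed.

(* Main.v *)
Require Import Defs.
From mathcomp Require Import all_boot all_order all_algebra.
From mathcomp Require Import all_classical all_reals.
From mathcomp Require Import zify ring lra.

(** Write [m = r^2 + r + 1] and [N = r^3 + r^2 + r + 1 = r m + 1], so that the
    hypothesis on [eps] reads [m / N <= eps < 1 / r].

    Lower bound, in any dimension [d]: a cover of the [d]-torus has at least
    [1 + r + ... + r^d] cubes.  Cut a cover of the [d.+1]-torus by the
    hyperplanes [x_0 = t]: the cubes met by each one cover a [d]-torus, so there
    are at least [S] of them, and each cube is met for a proportion [eps < 1 / r]
    of the values [t]; hence there are more than [r S] cubes
    ([cover_slice_card], [cover_card_ge]).  Averaging over sufficiently many
    equally spaced [t] replaces integration ([arc_sample_card]).

    Upper bound: the [N] cubes with corners [(j, r j, r^2 j) / N], one for each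
    [j] modulo [N], cover the torus.  Since [m / N <= eps], this reduces to a
    covering of [(Z/N)^3] by translates of the discrete cube of side [m]
    ([coverable_lattice]), that is, to finding [j] such that the three residues
    [k_i - r^i j] all lie in [[0, m)].  The first coordinate allows [m]
    consecutive values [j = k_0 - u].  Multiplication by [r] spreads these over
    [Z/N] in steps of [r], so that the second coordinate still allows [r + 1]
    values, which multiplication by [r^2] spreads in steps of about [r^2], so
    densely that the third coordinate allows at least one of them
    ([broken_progression_window], [plane_window]).  The identity
    [r^4 = 1 + (r - 1) N] controls what happens when the second window wraps
    around.

    The iterated ceiling is evaluated from [r < 1 / eps <= r + 1 / m]
    ([ceil_cascade]): its three stages are [r + 1], [m] and [N]. *)

Set Implicit Arguments.
Unset Strict Implicit.
Unset Printing Implicit Defensive.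

Import Order.TTheory GRing.Theory Num.Theory.

Local Open Scope quotient_scope.
Local Open Scope ring_scope.

(** * The lower bound *)

(** Multiplied by [M], the points of an arc whose classes are sample points
    become integers in a real interval of length [eps * M]; there are at most
    [truncn (eps * M) + 1] of those, and the sample point is recovered from the
    integer modulo [M]. *)
Lemma arc_sample_card (R : realType) (eps : R) (M : nat) (a : circle R) :
  0 <= eps -> (0 < M)%N ->
  (#|[set s : 'I_M | `[< Defs.arc eps a (\pi_(circle R) (s%:R / M%:R)) >]]|
     <= (Num.truncn (eps * M%:R)).+1)%N.
Proof.
case: M => // M eps0 _; set K := (Num.truncn _).+1.
(* [g] enumerates, modulo [M.+1], the [K] integers from [z0] on. *)
have M0 : (0 : R) < M.+1%:R by rewrite ltr0n.
pose u := repr a; pose z0 : int := Num.ceil (u * M.+1%:R).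
pose g (k : 'I_K) : 'I_M.+1 := inord `|((z0 + k%:Z) %% M.+1%:Z)%Z|%N.
rewrite -[K in (_ <= K)%N]card_ord -cardsT.
apply: leq_trans (leq_imset_card g _); apply/fintype.subset_leq_card/fintype.subsetP => s.
rewrite inE => /asboolP[t /= + /pi_circle_eq/intrP[q tq]].
rewrite in_itv /= -/u => /andP[ut tu].
pose z : int := s%:Z + M.+1%:Z * q.
have zE : z%:~R = t * M.+1%:R :> R.
  have -> : t = s%:R / M.+1%:R + q%:~R by rewrite -tq addrC subrK.
  by rewrite mulrDl divfK ?gt_eqF // intrD intrM [_ * q%:~R]mulrC.
have z0z : z0 <= z by rewrite /z0 ceil_le_int zE ler_pM2r.
have kK : (`|z - z0|%N < K)%N.
  have E : (`|z - z0|%N)%:R = (z - z0)%:~R :> R.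
    by rewrite -[LHS]/((`|z - z0|%N)%:Z%:~R) gez0_abs // subr_ge0.
  rewrite ltnS truncn_ge_nat ?mulr_ge0 // E.
  rewrite intrB zE; have := ceil_ge (u * M.+1%:R); rewrite -/z0 => h.
  have : t * M.+1%:R <= (u + eps) * M.+1%:R by rewrite ler_pM2r.
  by rewrite mulrDl; lra.
apply/imsetP; exists (Ordinal kK) => //; apply/val_inj; rewrite /g /=.
have -> : z0 + `|z - z0|%N%:Z = z by lia.
rewrite /z addrC mulrC modzMDl modz_small; last by have := ltn_ord s; lia.
exact: (esym (inordK (ltn_ord s))).
Qed.

(** Double counting of the pairs of an arc and a sample point on it: [M] points
    of multiplicity at least [S] require [M * S <= #|A| * L], with [L] the bound
    on the number of sample points of one arc.  As [eps < 1 / r] is strict, [L]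
    falls below [M / r] for [M] large. *)
Lemma cover_slice_card (R : realType) (r S : nat) (eps : R) (I : finType)
    (a : I -> circle R) (A : {set I}) :
  (0 < r)%N -> (0 < S)%N -> 0 <= eps -> eps < 1 / r%:R ->
  (forall t, (S <= #|[set i in A | `[< Defs.arc eps (a i) t >]]|)%N) ->
  (r * S < #|A|)%N.
Proof.
move=> r0 S0 eps0 epsr slice.
have r0R : (0 : R) < r%:R by rewrite ltr0n.
have d0 : 0 < 1 - eps * r%:R by rewrite subr_gt0 -ltr_pdivlMr.
(* [M] is chosen so that [r * (eps * M + 1) < M]. *)
pose M := (Num.truncn (r%:R / (1 - eps * r%:R))).+1.
have rM : r%:R < M%:R * (1 - eps * r%:R) by rewrite -ltr_pdivrMr // truncnS_gt.
pose L := (Num.truncn (eps * M%:R)).+1.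
have rL : (r * L < M)%N.
  have := truncn_le (eps * M%:R); rewrite mulr_ge0 // => h.
  rewrite -(ltr_nat R) natrM -natr1.
  by have : r%:R * (Num.truncn (eps * M%:R))%:R <= r%:R * (eps * M%:R);
     [rewrite ler_pM2l | lra].
have : (M * S <= #|A| * L)%N.
  pose p (s : 'I_M) := \pi_(circle R) (s%:R / M%:R).
  have -> : (M * S = \sum_(s < M) S)%N by rewrite sum_nat_const card_ord.
  apply: (@leq_trans (\sum_(s < M) \sum_(i in A) `[< Defs.arc eps (a i) (p s) >])).
    apply: leq_sum => s _; apply: leq_trans (slice (p s)) _.
    rewrite -sum1_card big_mkcond [leqRHS]big_mkcond /=.
    by apply: leq_sum => i _; rewrite inE; case: (i \in A) => //=; case: asbool.
  rewrite exchange_big /= -sum_nat_const; apply: leq_sum => i _.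
  apply: leq_trans (arc_sample_card (M := M) (a i) eps0 _) => //.
  rewrite -sum1_card [leqRHS]big_mkcond /=.
  by apply: leq_sum => s _; rewrite inE; case: asbool.
by nia.
Qed.

(** Covers are indexed by a subset [A] of an arbitrary finite type, so that the
    induction can pass to the cubes that meet a slice without renumbering. *)
Lemma cover_card_ge (R : realType) (r d : nat) (eps : R) (I : finType)
    (c : I -> torus R d) (A : {set I}) :
  (0 < r)%N -> 0 <= eps -> eps < 1 / r%:R ->
  (forall x, exists2 i, i \in A & subcube eps (c i) x) ->
  (\sum_(k < d.+1) r ^ k <= #|A|)%N.
Proof.
move=> r0 eps0 epsr; elim: d c A => [|d IHd] c A cover.
  rewrite big_ord1; have [i iA _] := cover (fun=> \pi_(circle R) 0).
  by apply/card_gt0P; exists i.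
rewrite big_ord_recl.
have -> : (\sum_(k < d.+1) r ^ lift ord0 k = r * \sum_(k < d.+1) r ^ k)%N.
  by rewrite big_distrr; apply: eq_bigr => k _; rewrite -[RHS]expnS.
apply: (@cover_slice_card _ _ _ eps _ (fun i => c i ord0)) => //.
  by rewrite big_ord_recl addn_gt0.
(* A point of the [d]-torus is completed by [t] to a point of the slice. *)
move=> t; apply: (IHd (fun i k => c i (lift ord0 k))) => x.
have [i iA cix] := cover (fun k => oapp x t (unlift ord0 k)).
exists i => [|k].
  by rewrite inE iA /=; apply/asboolP; have := cix ord0; rewrite unlift_none.
by have := cix (lift ord0 k); rewrite liftK.
Qed.

(** * A lattice covering of the discrete torus *)

Lemma int_residue (N : nat) (a : int) :
  (0 < N)%N -> exists s p : int, [/\ 0 <= s, s < N%:Z & a = s + p * N%:Z].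
Proof.
move=> N0; exists (a %% N)%Z, (a %/ N)%Z.
by split; [apply: modz_ge0; lia | apply: ltz_pmod; lia | rewrite addrC -divz_eq].
Qed.

Lemma ceil_quotient (n : nat) (a : int) :
  (0 < n)%N -> exists b : int, a <= n%:Z * b /\ n%:Z * b < a + n%:Z.
Proof.
move=> n0; have [s [p [s0 sn aE]]] := int_residue (- a) n0.
by exists (- p); split; nia.
Qed.

(** Membership of a residue modulo [N] in [[0, m)], with an explicit multiple of
    [N] in place of a remainder to keep all side conditions polynomial. *)
Definition in_window (N m : nat) (x : int) :=
  exists p : int, 0 <= x + p * N%:Z /\ x + p * N%:Z < m%:Z.

(** The numbers [r^2 v], [v <= r], with a shift by one from the index [e] on,
    meet every window of length [m] modulo [N]: consecutive ones differ by at
    most [r^2 + 1 <= m], and the cyclic gap from the last back to [0] is at most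
    [N - r^3 = m].  For [e > r] the progression is unbroken. *)
Lemma broken_progression_window (r e : nat) (b : int) :
  (0 < r)%N -> (0 < e)%N ->
  exists2 v : nat, (v <= r)%N &
    in_window (r ^ 3 + r ^ 2 + r + 1) (r ^ 2 + r + 1)
      (b + (r ^ 2 * v + (e <= v))%N%:Z).
Proof.
move=> r0 e0; set N := (r ^ 3 + r ^ 2 + r + 1)%N.
have [g [p [g0 gN bE]]] : exists g p : int, [/\ 0 <= g, g < N%:Z & - b = g + p * N%:Z].
  by apply: int_residue; rewrite /N addn1.
have [gr|gr] := leP g (r ^ 3)%N%:Z; last first.
  (* The window starts beyond [r^3] and contains [N], which is [0] again. *)
  exists 0%N => //; exists (p + 1).
  rewrite mulrDl mul1r muln0 leqNgt e0 /=; split; lia.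
have r2 : (0 < r ^ 2)%N by rewrite expn_gt0 r0.
have [w [gw wg]] := ceil_quotient g r2.
have w0 : 0 <= w by nia.
have wr : w <= r%:Z by rewrite expnS in gr; nia.
exists `|w|%N; first by lia.
by exists p; case: (e <= _)%N; split; nia.
Qed.

(** The condition on [a] asks that [r u] lie in [[s, s + m)] modulo [N], where
    [s] is the residue of [- a].  If [s <= r^3], this holds for [r + 1]
    consecutive values of [u].  Otherwise the window wraps around and the
    solutions split into [u = v] with [v < e] and [u = r^2 + v] with
    [e <= v <= r].  As [r^2 r^2 = 1] modulo [N], the multiples [r^2 u] then form
    a progression broken at [e]. *)
Lemma plane_window (r : nat) (a b : int) : (0 < r)%N ->
  exists u : int, [/\ 0 <= u, u < (r ^ 2 + r + 1)%N%:Z,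
    in_window (r ^ 3 + r ^ 2 + r + 1) (r ^ 2 + r + 1) (a + r%:Z * u) &
    in_window (r ^ 3 + r ^ 2 + r + 1) (r ^ 2 + r + 1) (b + r%:Z ^+ 2 * u)].
Proof.
move=> r0; set N := (r ^ 3 + r ^ 2 + r + 1)%N; set m := (r ^ 2 + r + 1)%N.
have [s [p [s0 sN aE]]] : exists s p : int, [/\ 0 <= s, s < N%:Z & - a = s + p * N%:Z].
  by apply: int_residue; rewrite /N addn1.
have NE : N%:Z = r%:Z * r%:Z * r%:Z + r%:Z * r%:Z + r%:Z + 1.
  by rewrite /N !expnS expn0; lia.
have mE : m%:Z = r%:Z * r%:Z + r%:Z + 1 by rewrite /m !expnS expn0; lia.
have [sr|sr] := leP s (r%:Z * r%:Z * r%:Z).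
- have [w [sw ws]] := ceil_quotient s r0.
  have w0 : 0 <= w by nia.
  have wr : w <= r%:Z * r%:Z by nia.
  have [v vr [q [q0 qm]]] := @broken_progression_window r r.+1 (b + r%:Z ^+ 2 * w) r0 isT.
  exists (w + v%:Z); split; [lia | lia | exists p; split; nia | exists q].
  rewrite ltnNge vr addn0 -/N -/m in q0 qm.
  have E : (r ^ 2 * v)%N%:Z = r%:Z ^+ 2 * v%:Z by rewrite -mulnn !PoszM.
  by rewrite mulrDr addrA -E.
- have [e [re er]] := ceil_quotient (s - r%:Z * r%:Z * r%:Z) r0.
  have e0 : (0 < `|e|)%N by nia.
  have [v vr [q [q0 qm]]] := @broken_progression_window r `|e|%N b r0 e0.
  rewrite -/N -/m in q0 qm.
  have E : (r ^ 2 * v)%N%:Z = r%:Z ^+ 2 * v%:Z by rewrite -mulnn !PoszM.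
  rewrite PoszD E in q0 qm.
  have [ev|ve] := leqP `|e|%N v.
  + exists (r%:Z * r%:Z + v%:Z); split; [lia | lia | exists p; split; nia |].
    have {}E : b + r%:Z ^+ 2 * (r%:Z * r%:Z + v%:Z) =
      b + (r%:Z ^+ 2 * v%:Z + 1) + (r%:Z - 1) * N%:Z by rewrite NE; ring.
    rewrite ev in q0 qm.
    by exists (q - r%:Z + 1); rewrite E; split; lia.
  + exists v%:Z; split; [lia | lia | exists (p + 1); split; nia |].
    by exists q; rewrite leqNgt ve addr0 in q0 qm.
Qed.

(** The first coordinate forces [j = k_0 - u] with [u] in [[0, m)]; substituted
    in the other two coordinates, this is the planar problem for [u]. *)
Lemma space_window (r : nat) (k : 'I_3 -> int) : (0 < r)%N ->
  exists j : 'I_(r ^ 3 + r ^ 2 + r + 1), forall i,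
    in_window (r ^ 3 + r ^ 2 + r + 1) (r ^ 2 + r + 1) (k i - r%:Z ^+ i * j%:Z).
Proof.
move=> r0; set N := (r ^ 3 + r ^ 2 + r + 1)%N; set m := (r ^ 2 + r + 1)%N.
pose k0 := k ord0; pose k1 := k (inord 1); pose k2 := k (inord 2).
have [u [u0 um [p1 h1] [p2 h2]]] :=
  plane_window (k1 - r%:Z * k0) (k2 - r%:Z ^+ 2 * k0) r0.
rewrite -/N -/m in um h1 h2.
have [j [q [j0 jN jE]]] : exists j q : int,
    [/\ 0 <= j, j < N%:Z & k0 - u = j + q * N%:Z].
  by apply: int_residue; rewrite /N addn1.
have jN' : (`|j| < N)%N by lia.
exists (Ordinal jN') => i /=; rewrite gez0_abs //.
have -> : j = k0 - u - q * N%:Z by rewrite jE addrK.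
have [->|->|->] : [\/ i = ord0, i = inord 1 | i = inord 2].
- by case: i => [[|[|[|//]]] ilt];
    [apply: Or31 | apply: Or32 | apply: Or33]; apply: val_inj; rewrite /= ?inordK.
- exists (- q); rewrite -/k0 expr0.
  by have -> : k0 - 1 * (k0 - u - q * N%:Z) + - q * N%:Z = u by ring.
- exists (p1 - r%:Z * q); rewrite -/k1 inordK // expr1.
  have -> // : k1 - r%:Z * (k0 - u - q * N%:Z) + (p1 - r%:Z * q) * N%:Z =
    k1 - r%:Z * k0 + r%:Z * u + p1 * N%:Z by ring.
- exists (p2 - r%:Z ^+ 2 * q); rewrite -/k2 inordK //.
  have -> // : k2 - r%:Z ^+ 2 * (k0 - u - q * N%:Z) + (p2 - r%:Z ^+ 2 * q) * N%:Z =
    k2 - r%:Z ^+ 2 * k0 + r%:Z ^+ 2 * u + p2 * N%:Z by ring.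
Qed.

(** * From the discrete torus to the real one *)

(** The grid cell [[k, k + 1] / N] lies in the arc [[c, c + m] / N] as soon as
    [k - c] is one of [0, ..., m - 1], so covering the cells of the discrete
    torus covers all points. *)
Lemma coverable_lattice (R : realType) (d N m : nat) (w : 'I_d -> int) (eps : R) :
  (0 < N)%N -> m%:R / N%:R <= eps ->
  (forall k : 'I_d -> int, exists j : 'I_N, forall i,
    in_window N m (k i - w i * j%:Z)) ->
  coverable d eps N.
Proof.
move=> N0 mN hit; have N0R : (0 : R) < N%:R by rewrite ltr0n.
exists (fun (j : 'I_N) i => \pi_(circle R) ((w i * j%:Z)%:~R / N%:R)).
apply/seteqP; split=> // x _.
pose t i := repr (x i) * N%:R.
have [j hj] := hit (fun i => Num.floor (t i)).
exists j => // i; rewrite arc_pi /=.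
have [p [p0 pm]] := hj i.
(* The representative of [x i] in the arc is shifted by the number [p] of turns
   made by [k i - w i * j]. *)
exists (repr (x i) + p%:~R); last first.
  rewrite -[RHS]reprK; apply/pi_circle_eq.
  by rewrite addrAC subrr add0r; apply: intr_int.
have tE : repr (x i) = t i / N%:R by rewrite mulfK ?gt_eqF.
have pE : p%:~R = (p * N%:Z)%:~R / N%:R :> R by rewrite intrM mulfK ?gt_eqF.
have le_t := floor_le (t i); have lt_t := floorD1_gt (t i).
rewrite in_itv /= tE pE -mulrDl ler_pM2r ?invr_gt0 //; apply/andP; split.
  by move: p0; rewrite -(ler_int R) !rmorphD rmorphN /= intrM; lra.
apply: le_trans (lerD (lexx _) mN); rewrite -mulrDl ler_pM2r ?invr_gt0 //.
move: pm; rewrite -lezD1 -(ler_int R) !rmorphD rmorphN /= in lt_t *.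
by lra.
Qed.

(** * The value of the iterated ceiling *)

(** The product lies in [(r n, r n + n / m]], and [n / m <= 1]. *)
Lemma ceil_cascade (R : realType) (r m n : nat) (y : R) :
  r%:R < y -> y <= r%:R + 1 / m%:R -> (0 < n)%N -> (n <= m)%N ->
  Num.ceil (y * (n%:Z)%:~R) = (r * n + 1)%N.
Proof.
move=> ry ym n0 nm; apply: ceil_def.
have n0R : (0 : R) < n%:R by rewrite ltr0n.
have m0R : (0 : R) < m%:R by rewrite ltr0n (leq_trans n0).
rewrite PoszD addrK -PoszD -!pmulrn natrD natrM; apply/andP; split.
  by rewrite ltr_pM2r.
apply: (@le_trans _ _ ((r%:R + 1 / m%:R) * n%:R)); first by rewrite ler_pM2r.
by rewrite mulrDl lerD2l mulrAC mul1r ler_pdivrMr // mul1r ler_nat.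
Qed.

Theorem theorem1 (R : realType) (r : nat) (eps : R) (hr : (0 < r)%N)
    (heps_ge : 1 / (r%:R + 1 / (r ^ 2 + r + 1)%N%:R) <= eps)
    (heps_lt : eps < 1 / r%:R) :
  (mu 3 eps)%:Z =
    Num.ceil (1 / eps * (Num.ceil (1 / eps * (Num.ceil (1 / eps))%:~R))%:~R)
  /\ mu 3 eps = (r ^ 3 + r ^ 2 + r + 1)%N.
Proof.
set m := (r ^ 2 + r + 1)%N in heps_ge *; set N := (r ^ 3 + r ^ 2 + r + 1)%N.
have r0 : (0 : R) < r%:R by rewrite ltr0n.
have m0 : (0 : R) < m%:R by rewrite ltr0n /m addn1.
have s0 : 0 < r%:R + 1 / m%:R :> R by rewrite addr_gt0 ?divr_gt0.
have eps0 : 0 < eps by apply: lt_le_trans heps_ge; rewrite divr_gt0.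
have NE : N = (r * m + 1)%N by rewrite /N /m !expnS expn0; lia.
have mE : m = (r * (r * 1 + 1) + 1)%N by rewrite /m !expnS expn0; lia.
have mN : m%:R / N%:R <= eps.
  apply: le_trans heps_ge; rewrite NE natrD natrM le_eqVlt; apply/orP; left.
  by apply/eqP; field; rewrite ?gt_eqF // addr_gt0 // mulr_gt0.
have muE : mu 3 eps = N.
  have cov : coverable 3 eps N.
    apply: (@coverable_lattice _ _ _ m (fun i => r%:Z ^+ i)) => //.
      by rewrite NE addn1.
    by move=> k; apply: space_window.
  have [[c cE] muN] := mu_min cov.
  apply/eqP; rewrite eqn_leq muN //=.
  have : (\sum_(k < 4) r ^ k <= #|[set: 'I_(mu 3 eps)]|)%N.
    apply: (@cover_card_ge _ _ _ eps _ c) => //; first exact: ltW.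
    move=> x; have : (\bigcup_i subcube eps (c i))%classic x by rewrite cE.
    by case=> i _ cix; exists i; rewrite ?inE.
  rewrite cardsT card_ord !big_ord_recr big_ord0 /= expn0 expn1 /N.
  by apply: leq_trans; lia.
split=> //; rewrite muE.
have ry : r%:R < 1 / eps.
  by rewrite ltr_pdivlMr // mulrC -ltr_pdivlMr.
have ym : 1 / eps <= r%:R + 1 / m%:R.
  by rewrite ler_pdivrMr // mulrC -ler_pdivrMr.
have rm : (r * 1 + 1 <= m)%N by rewrite mE; nia.
have ceil1 : Num.ceil (1 / eps) = (r * 1 + 1)%N.
  by rewrite -(ceil_cascade ry ym) ?mulr1 // (leq_trans _ rm) ?addn1.
have ceil2 : Num.ceil (1 / eps * (r * 1 + 1)%N%:~R) = m.
  by rewrite (ceil_cascade ry ym) -?mE // addn1.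
rewrite ceil1 ceil2 (ceil_cascade ry ym) ?NE //.
by rewrite /m addn1.
Qed.
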